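(* For any $\Omega$-test $\Theta$ and process $\Delta$, $\mathcal A^{d}(\Theta,\Delta)=\mathcal A(\Theta,\Delta)$.
   Context: Subdistributions over $S$: $\Delta:S\to[0,1]$, $\sum_s\Delta(s)\le1$, support $\lceil\Delta\rceil$, pointwise sums/scalar multiples, $\overline s$ point distribution; $\mathrm{Exp}_\Delta(f)=\sum_s\Delta(s)f(s)$ componentwise; $f(\Delta)(t)=\sum_{f(s)=t}\Delta(s)$. A pLTS $\langle S,L,\to\rangle$ has $\to\subseteq S\times(L\cup\{\tau\})\times\mathcal D(S)$ ($\mathcal D(S)$ full distributions, $\tau\notin L$); deterministic: at most one $\Delta$ with $s\xrightarrow{\alpha}\Delta$ per $s,\alpha$. Processes are distributions over a fixed pLTS $\langle\mathbf P,\mathsf{Act},\to_{\mathbf P}\rangle$. $\Omega$ is a set of success actions disjoint from $\mathsf{Act}\cup\{\tau\}$; $\Omega$-tests are distributions over a fixed pLTS $\langle\mathbf T,\mathsf{Act}\cup\Omega,\to_{\mathbf T}\rangle$ whose states satisfy (A) $t\xrightarrow{\omega_1},t\xrightarrow{\omega_2}$ with $\omega_i\in\Omega$ imply $\omega_1=\omega_2$; (B) if $t\xrightarrow{\omega}$ ($\omega\in\Omega$) and $t\xrightarrow{\alpha}\Delta$ ($\alpha\in\mathsf{Act}\cup\{\tau\}$) then $u\xrightarrow{\omega}$ for all $u\in\lceil\Delta\rceil$. The pLTS $\langle\mathbf C,\Omega,\to\rangle$, $\mathbf C=\{t\|p\}$, has transitions: $t\xrightarrow{\alpha}_{\mathbf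 T}\Theta$, $\alpha\notin\mathsf{Act}$ gives $t\|p\xrightarrow{\alpha}\Theta\|\overline p$; $p\xrightarrow{\tau}_{\mathbf P}\Delta$ gives $t\|p\xrightarrow{\tau}\overline t\|\Delta$; $t\xrightarrow{a}_{\mathbf T}\Theta$, $p\xrightarrow{a}_{\mathbf P}\Delta$, $a\in\mathsf{Act}$ give $t\|p\xrightarrow{\tau}\Theta\|\Delta$; $(\Theta\|\Delta)(t\|p)=\Theta(t)\Delta(p)$. Resolution of $\Delta$ in $\langle S,\Omega,\to\rangle$: $\langle R,\Lambda,\to_R\rangle$ with $\langle R,\Omega,\to_R\rangle$ deterministic, $\Lambda$ a subdistribution over $R$, and $f:R\to S$ with $f(\Lambda)=\Delta$, $r\xrightarrow{\alpha}_R\Lambda''\Rightarrow f(r)\xrightarrow{\alpha}f(\Lambda'')$, $f(r)\xrightarrow{\alpha}\Rightarrow r\xrightarrow{\alpha}_R$ ($\alpha\in\Omega\cup\{\tau\}$). $\mathbb V_{\langle R,\Omega,\to_R\rangle}$ is the least fixed point of $\mathcal R(f)(r)(\omega)=1$ if $r\xrightarrow{\omega}$; $0$ if $r\not\xrightarrow{\omega},r\not\xrightarrow{\tau}$; $\mathrm{Exp}_{\Delta}(f)(\omega)$ if $r\not\xrightarrow{\omega}$, $r\xrightarrow{\tau}\Delta$. $\mathcal A(\Theta,\Delta)=\{\mathrm{Exp}_\Lambda(\mathbb V_{\langle R,\Omega,\to_R\rangle})\mid\langle R,\Lambda,\to_R\rangle\text{ a resolution of }\Theta\|\Delta\}$.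 Pruning: from $\langle\mathbf C,\Omega,\to\rangle$ remove every transition $s\xrightarrow{\tau}\Delta$ for which $s\xrightarrow{\omega}$ for some $\omega\in\Omega$; $[\Theta\|\Delta]$ denotes $\Theta\|\Delta$ regarded in the pruned pLTS. Lifting of $\mathcal R\subseteq S\times\mathcal D_{sub}(S)$: smallest relation on subdistributions with $\overline s\,\overline{\mathcal R}\,\Delta$ when $s\mathcal R\Delta$, closed under $(\sum_ip_i\Gamma_i)\overline{\mathcal R}(\sum_ip_i\Delta_i)$ for $\Gamma_i\overline{\mathcal R}\Delta_i$, $p_i\in[0,1]$, $\sum_ip_i\le1$, $I$ arbitrary. $\Delta\Rightarrow\Delta'$ iff there are $\Delta_k^\to,\Delta_k^\times$ with $\Delta=\Delta_0^\to+\Delta_0^\times$, $\Delta_k^\to\xrightarrow{\tau}\Delta_{k+1}^\to+\Delta_{k+1}^\times$ (lifted), $\Delta'=\sum_k\Delta_k^\times$. Stable: no state in the support has a $\tau$-transition; $\Delta\Rightarrow_{\mathrm E}\Delta'$ iff $\Delta\Rightarrow\Delta'$, $\Delta'$ stable. Outcome of a stable $\Delta$: $\$(\Delta)(\omega)=\sum\{\Delta(s)\mid s\in\lceil\Delta\rceil,s\xrightarrow{\omega}\}$. $\mathcal A^{d}(\Theta,\Delta)=\{\$(\Lambda)\mid[\Theta\|\Delta]\Rightarrow_{\mathrm E}\Lambda\}$ (derivations taken in the pruned pLTS). *)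

(* Defs.v *)
From HB Require Import structures.
From mathcomp Require Import all_boot all_order all_algebra.
From mathcomp Require Import mathcomp_extra boolp classical_sets functions.
From mathcomp Require Import reals ereal constructive_ereal fsbigop esum.

Set Implicit Arguments.
Unset Strict Implicit.
Unset Printing Implicit Defensive.

Import Order.TTheory GRing.Theory Num.Theory.
Local Open Scope classical_set_scope.
Local Open Scope ring_scope.

(* State and index sets are choiceTypes because esum requires one. The value is
   meaningful for g nonnegative on A with a finite sum, the only case used. *)
Definition rsum (R : realType) (I : choiceType) (A : set I) (g : I -> R) : R :=
  fine (\esum_(i in A) (g i)%:E).

Definition is_subdistr (R : realType) (S : choiceType) (D : S -> R) : Prop :=
  (forall s, 0 <= D s) /\ (\esum_(s in [set: S]) (D s)%:E <= 1%:E)%E.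

Definition is_distr (R : realType) (S : choiceType) (D : S -> R) : Prop :=
  (forall s, 0 <= D s) /\ \esum_(s in [set: S]) (D s)%:E = 1%:E.

Definition supp (R : realType) (S : choiceType) (D : S -> R) : set S :=
  [set s | 0 < D s].

Definition point_distr (R : realType) (S : choiceType) (s : S) : S -> R :=
  fun x => (x == s)%:R.

Definition expect (R : realType) (S : choiceType) (D : S -> R) (f : S -> R) : R :=
  rsum [set: S] (fun s => D s * f s).

Definition push (R : realType) (S S' : choiceType) (f : S -> S') (D : S -> R) :
    S' -> R :=
  fun t => rsum (f @^-1` [set t]) D.

Definition prod_distr (R : realType) (T P : choiceType)
    (Theta : T -> R) (Delta : P -> R) : T * P -> R :=
  fun c => Theta c.1 * Delta c.2.

(* The label None is tau, so tau is outside L by construction. *)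
Record plts (R : realType) (S : choiceType) (L : Type) := Plts {
  step :> S -> option L -> (S -> R) -> Prop;
  step_distr : forall s a D, step s a D -> is_distr D }.

Definition enabled (R : realType) (S : choiceType) (L : Type)
    (M : plts R S L) (s : S) (a : option L) : Prop :=
  exists D, M s a D.

Definition deterministic (R : realType) (S : choiceType) (L : Type)
    (M : plts R S L) : Prop :=
  forall s a D D', M s a D -> M s a D' -> D = D'.

(* Action labels of tests: inl for Act, inr for the success actions Omega. *)
Definition test_condA (R : realType) (T : choiceType) (Act Omega : Type)
    (MT : plts R T (Act + Omega)) : Prop :=
  forall t (w1 w2 : Omega),
    enabled MT t (Some (inr w1)) -> enabled MT t (Some (inr w2)) -> w1 = w2.

Definition test_condB (R : realType) (T : choiceType) (Act Omega : Type)
    (MT : plts R T (Act + Omega)) : Prop :=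
  forall t (w : Omega) (a : option Act) D,
    enabled MT t (Some (inr w)) -> MT t (omap inl a) D ->
    forall u, supp D u -> enabled MT u (Some (inr w)).

Inductive par_step (R : realType) (T P : choiceType) (Act Omega : Type)
    (MT : plts R T (Act + Omega)) (MP : plts R P Act) :
    T * P -> option Omega -> (T * P -> R) -> Prop :=
| par_test t p (a : option Omega) Theta :
    MT t (omap inr a) Theta ->
    par_step MT MP (t, p) a (prod_distr Theta (point_distr R p))
| par_proc t p Delta :
    MP p None Delta ->
    par_step MT MP (t, p) None (prod_distr (point_distr R t) Delta)
| par_sync t p (a : Act) Theta Delta :
    MT t (Some (inl a)) Theta -> MP p (Some a) Delta ->
    par_step MT MP (t, p) None (prod_distr Theta Delta).

Lemma esumZl (R : realType) (I : choiceType) (A : set I) (r : R) (g : I -> \bar R) :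
  0 <= r -> (forall i, (0 <= g i)%E) ->
  (\esum_(i in A) (r%:E * g i) = r%:E * \esum_(i in A) g i)%E.
Proof.
move=> r0 g0; rewrite /esum -ereal_supZl//; last first.
  by apply/set0P; eexists; exists set0; first exact: fsets_set0.
congr ereal_sup; apply/seteqP; split=> x /=.
  move=> [F AF <-]; exists (\sum_(i \in F) g i)%E; first by exists F.
  by rewrite ge0_mule_fsumr.
by move=> [_ [F AF <-] <-]; exists F => //; rewrite ge0_mule_fsumr.
Qed.

Lemma point_distr_is_distr (R : realType) (S : choiceType) (s : S) :
  is_distr (point_distr R s).
Proof.
split=> [x|]; first by rewrite /point_distr ler0n.
rewrite (esumID [set s]); last by move=> x _; rewrite lee_fin ler0n.
rewrite setTI esum_set1 ?lee_fin ?ler0n// /point_distr eqxx.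
rewrite esum1 ?adde0// => x [_ /= /eqP/negPf xs].
by rewrite xs.
Qed.

Lemma prod_distr_is_distr (R : realType) (T P : choiceType)
    (Theta : T -> R) (Delta : P -> R) :
  is_distr Theta -> is_distr Delta -> is_distr (prod_distr Theta Delta).
Proof.
move=> [Theta0 Theta1] [Delta0 Delta1].
split=> [c|]; first exact: mulr_ge0.
have -> : [set: T * P] = [set: T] `*`` (fun=> [set: P]).
  by apply/seteqP; split.
rewrite -(@esum_esum R T P setT (fun=> setT)
  (fun t p => (Theta t * Delta p)%:E)); last first.
  by move=> t p _ _; rewrite lee_fin mulr_ge0.
rewrite -Theta1; apply: eq_esum => t _.
under eq_esum do rewrite EFinM.
by rewrite esumZl// ?Delta1 ?mule1// => p; rewrite lee_fin.
Qed.

Lemma par_step_distr (R : realType) (T P : choiceType) (Act Omega : Type)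
    (MT : plts R T (Act + Omega)) (MP : plts R P Act) c a D :
  par_step MT MP c a D -> is_distr D.
Proof.
by case=> *; apply: prod_distr_is_distr;
  do ?[exact: point_distr_is_distr | apply: step_distr; eassumption].
Qed.

Definition par (R : realType) (T P : choiceType) (Act Omega : Type)
    (MT : plts R T (Act + Omega)) (MP : plts R P Act) :
    plts R (T * P)%type Omega :=
  Plts (@par_step_distr R T P Act Omega MT MP).

Definition unit_valued (R : realType) (S : choiceType) (Omega : Type)
    (V : S -> Omega -> R) : Prop :=
  forall s w, 0 <= V s w <= 1.

(* In a deterministic pLTS the distribution picked by cid is the only one. *)
Definition value_op (R : realType) (S : choiceType) (Omega : Type)
    (M : plts R S Omega) (V : S -> Omega -> R) : S -> Omega -> R :=
  fun s w =>
    if pselect (enabled M s (Some w)) then 1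
    else match pselect (enabled M s None) with
         | left tau => expect (projT1 (cid tau)) (V ^~ w)
         | right _ => 0
         end.

(* V is the least fixed point of value_op among functions into [0,1]^Omega. *)
Definition is_value (R : realType) (S : choiceType) (Omega : Type)
    (M : plts R S Omega) (V : S -> Omega -> R) : Prop :=
  [/\ unit_valued V, value_op M V = V &
      forall W, unit_valued W -> value_op M W = W ->
        forall s w, V s w <= W s w].

Definition is_resolution (R : realType) (S : choiceType) (Omega : Type)
    (M : plts R S Omega) (Delta : S -> R)
    (U : choiceType) (Lambda : U -> R) (N : plts R U Omega) : Prop :=
  [/\ deterministic N, is_subdistr Lambda &
      exists f : U -> S,
        [/\ push f Lambda = Delta,
            forall r a L, N r a L -> M (f r) a (push f L) &
            forall r a, enabled M (f r) a -> enabled N r a]].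

Definition outcomes (R : realType) (T P : choiceType) (Act Omega : Type)
    (MT : plts R T (Act + Omega)) (MP : plts R P Act)
    (Theta : T -> R) (Delta : P -> R) : set (Omega -> R) :=
  [set o | exists (U : choiceType) (Lambda : U -> R) (N : plts R U Omega)
             (V : U -> Omega -> R),
      [/\ is_resolution (par MT MP) (prod_distr Theta Delta) Lambda N,
          is_value N V &
          o = fun w => expect Lambda (V ^~ w)]].

Definition prune_step (R : realType) (S : choiceType) (Omega : Type)
    (M : plts R S Omega) (s : S) (a : option Omega) (D : S -> R) : Prop :=
  M s a D /\ ~ (a = None /\ exists w, enabled M s (Some w)).

Lemma prune_step_distr (R : realType) (S : choiceType) (Omega : Type)
    (M : plts R S Omega) s a D :
  prune_step M s a D -> is_distr D.
Proof. by case=> /step_distr. Qed.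

Definition prune (R : realType) (S : choiceType) (Omega : Type)
    (M : plts R S Omega) : plts R S Omega :=
  Plts (@prune_step_distr R S Omega M).

Inductive lift (R : realType) (S : choiceType) (Q : S -> (S -> R) -> Prop) :
    (S -> R) -> (S -> R) -> Prop :=
| lift_point s D : Q s D -> lift Q (point_distr R s) D
| lift_sum (I : choiceType) (p : I -> R) (G D : I -> S -> R) :
    is_subdistr p -> (forall i, lift Q (G i) (D i)) ->
    lift Q (fun s => rsum [set: I] (fun i => p i * G i s))
           (fun s => rsum [set: I] (fun i => p i * D i s)).

Definition tau_step (R : realType) (S : choiceType) (L : Type)
    (M : plts R S L) : (S -> R) -> (S -> R) -> Prop :=
  lift (fun s D => M s None D).

Definition derivation (R : realType) (S : choiceType) (L : Type)
    (M : plts R S L) (Delta Delta' : S -> R) : Prop :=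
  exists Dgo Dstop : nat -> S -> R,
    [/\ forall k, is_subdistr (Dgo k) /\ is_subdistr (Dstop k),
        Delta = (fun s => Dgo 0%N s + Dstop 0%N s),
        forall k, tau_step M (Dgo k) (fun s => Dgo k.+1 s + Dstop k.+1 s) &
        Delta' = (fun s => rsum [set: nat] (fun k => Dstop k s))].

Definition stable (R : realType) (S : choiceType) (L : Type)
    (M : plts R S L) (Delta : S -> R) : Prop :=
  forall s, supp Delta s -> ~ enabled M s None.

Definition extreme_derivation (R : realType) (S : choiceType) (L : Type)
    (M : plts R S L) (Delta Delta' : S -> R) : Prop :=
  derivation M Delta Delta' /\ stable M Delta'.

Definition stable_outcome (R : realType) (S : choiceType) (Omega : Type)
    (M : plts R S Omega) (Delta : S -> R) : Omega -> R :=
  fun w => rsum [set s | supp Delta s /\ enabled M s (Some w)] Delta.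

Definition outcomes_d (R : realType) (T P : choiceType) (Act Omega : Type)
    (MT : plts R T (Act + Omega)) (MP : plts R P Act)
    (Theta : T -> R) (Delta : P -> R) : set (Omega -> R) :=
  [set stable_outcome (prune (par MT MP)) Lambda | Lambda in
    [set Lambda |
      extreme_derivation (prune (par MT MP)) (prod_distr Theta Delta) Lambda]].

(* Main.v *)
Require Import Defs.
From mathcomp Require Import all_boot all_order all_algebra.
From mathcomp Require Import boolp classical_sets functions reals ereal.
From mathcomp Require Import filter normedtype sequences esum.

(** Let [hit w n r] be the probability that a resolution started in [r] succeeds
    with [w] after exactly [n] tau-steps of states that have not yet succeeded.
    Conditions (A) and (B) make the least fixed point of the value operator equal
    to the sum of [hit w n] over [n]. Hence, whenever the mass of a resolution
    evolves by letting the part on active states move and the rest stop, its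
    expected value at [w] is the total mass stopped at states that enable [w].

    From a resolution, the push-forward of this evolution is an extreme
    derivation with the same outcome. Conversely, each lifted step of a derivation
    splits into countably many weighted transitions, and the states of the
    resolution are states of the pLTS tagged with the step and transition by which
    they leave, or with the information that they stop; tags are distributed by
    conditional probability, so that the evolution of the resolution projects
    onto the derivation. *)

Set Implicit Arguments.
Unset Strict Implicit.
Unset Printing Implicit Defensive.

Import Order.TTheory GRing.Theory Num.Theory.
Local Open Scope classical_set_scope.
Local Open Scope ring_scope.
Local Open Scope ereal_scope.

(** * Sums over arbitrary index sets *)

Section Esum.
Variable R : realType.

Lemma exchange_esum (I J : choiceType) (A : set I) (B : set J)
    (a : I -> J -> \bar R) : (forall i j, 0 <= a i j) ->
  \esum_(i in A) \esum_(j in B) a i j = \esum_(j in B) \esum_(i in A) a i j.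
Proof.
move=> a0; rewrite !esum_esum//.
apply: (@reindex_esum _ _ _ _ _ (fun x : J * I => (x.2, x.1)) (fun x => a x.1 x.2)).
split=> [[j i] /= [] ?? //|[j i] [j' i'] _ _ /= [-> ->]//|[i j] /= [Ai Bj]].
by exists (j, i).
Qed.

Lemma ge0_esumZr (I : choiceType) (A : set I) (r : R) (g : I -> \bar R) :
  (0 <= r)%R -> (forall i, 0 <= g i) ->
  \esum_(i in A) (g i * r%:E) = (\esum_(i in A) g i) * r%:E.
Proof.
move=> r0 g0; rewrite muleC -esumZl//; apply: eq_esum => i _; exact: muleC.
Qed.

Lemma esum_le_subset (I : choiceType) (A B : set I) (g : I -> \bar R) :
  A `<=` B -> (forall i, 0 <= g i) -> \esum_(i in A) g i <= \esum_(i in B) g i.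
Proof.
move=> AB g0; rewrite [leRHS](esumID A)//.
by rewrite setIidr// leeDl//; apply: esum_ge0.
Qed.

Lemma esum_ge_term (I : choiceType) (A : set I) (g : I -> \bar R) i :
  A i -> (forall j, 0 <= g j) -> g i <= \esum_(j in A) g j.
Proof.
move=> Ai g0; rewrite -(@esum_set1 _ _ i g)//.
by apply: esum_le_subset => // _ ->.
Qed.

Lemma esum_single (I : choiceType) (A : set I) (g : I -> \bar R) i :
  A i -> 0 <= g i -> (forall j, j != i -> g j = 0) -> \esum_(j in A) g j = g i.
Proof.
move=> Ai gi0 gj.
have g0 j : 0 <= g j by have [->//|/gj ->] := eqVneq j i.
rewrite (esumID [set i])// setIidr; last by move=> _ ->.
by rewrite esum_set1// (esum1 (D := A `&` _)) ?adde0// => j [_ /eqP/gj].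
Qed.

Lemma esum_inj (I J : choiceType) (h : I -> J) (g : J -> \bar R) :
  injective h -> (forall j, 0 <= g j) -> (forall j, ~ range h j -> g j = 0) ->
  \esum_(j in [set: J]) g j = \esum_(i in [set: I]) g (h i).
Proof.
move=> hinj g0 gz; rewrite (esumID (range h))// [X in _ + X]esum1; last first.
  by move=> j [_ /gz].
by rewrite adde0 setTI esum_image// => i j _ _; exact: hinj.
Qed.

(** Once the sums are exchanged, each [i] contributes to the single index [f i]. *)
Lemma esum_fibers (I J : choiceType) (f : I -> J) (B : set J) (g : I -> \bar R) :
  (forall i, 0 <= g i) ->
  \esum_(j in B) \esum_(i in f @^-1` [set j]) g i = \esum_(i in f @^-1` B) g i.
Proof.
move=> g0; under eq_esum do rewrite esum_mkcond.
rewrite exchange_esum; last by move=> j i; case: ifP.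
rewrite [RHS]esum_mkcond; apply: eq_esum => i _.
have [fi|fi] := boolP (i \in f @^-1` B).
  rewrite (@esum_single _ _ _ (f i)).
  - by rewrite mem_set.
  - by move: fi; rewrite inE.
  - by case: ifP.
  - by move=> j ji; rewrite memNset//= => fij; rewrite fij eqxx in ji.
rewrite esum1// => j Bj; rewrite memNset// => /= fij.
by move/negP: fi; apply; rewrite inE /= fij.
Qed.

Lemma esum_option (I : choiceType) (g : option I -> \bar R) :
  (forall i, 0 <= g i) ->
  \esum_(i in [set: option I]) g i = g None + \esum_(i in [set: I]) g (Some i).
Proof.
move=> g0; rewrite (esumID [set None])// setTI esum_set1//; congr (_ + _).
rewrite setTI -(@esum_image _ _ _ setT Some g); last by move=> i j _ _ [].
congr esum; apply/seteqP; split=> [[i|]/= i0|_ [i _ <-]//].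
  by exists i.
by case: i0.
Qed.

Lemma esum_pair (I J : choiceType) (g : I * J -> \bar R) :
  (forall i, 0 <= g i) ->
  \esum_(i in [set: I * J]) g i = \esum_(i in [set: I]) \esum_(j in [set: J]) g (i, j).
Proof.
move=> g0; rewrite (@esum_esum _ _ _ _ _ (fun i j => g (i, j)))//.
have -> : [set: I * J] = [set: I] `*`` (fun=> [set: J]) by apply/seteqP; split.
by apply: eq_esum => -[].
Qed.

Lemma esum_nat_le (a : nat -> \bar R) (c : \bar R) : (forall k, 0 <= a k) ->
  (forall n, \sum_(k < n) a k <= c) -> \esum_(k in [set: nat]) a k <= c.
Proof.
move=> a0 ac; rewrite -nneseries_esumT//; apply: lime_le.
  exact: is_cvg_nneseries.
by apply: nearW => n; rewrite big_mkord.
Qed.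

Lemma esum_natS (a : nat -> \bar R) : (forall k, 0 <= a k) ->
  \esum_(k in [set: nat]) a k = a 0%N + \esum_(k in [set: nat]) a k.+1.
Proof.
move=> a0; rewrite (esumID [set 0%N])// setTI esum_set1//; congr (_ + _).
rewrite setTI -(@esum_image _ _ _ setT S a); last by move=> i j _ _ [].
congr esum; apply/seteqP; split=> [[|i]/= i0|_ [i _ <-]//].
  by case: i0.
by exists i.
Qed.

(** With [a] the mass still moving and [b] the mass split off at each step, the quantity
    [\sum_(k < n.+1) b k + a n] never exceeds [c]. *)
Lemma esum_telescope_le (a b : nat -> \bar R) (c : \bar R) :
  (forall k, 0 <= a k) -> (forall k, 0 <= b k) ->
  a 0%N + b 0%N <= c -> (forall k, a k.+1 + b k.+1 <= a k) ->
  \esum_(k in [set: nat]) b k <= c.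
Proof.
move=> a0 b0 c0 ab; apply: esum_nat_le => // n.
suff H : \sum_(k < n.+1) b k + a n <= c.
  by apply: le_trans H; rewrite big_ord_recr/= -addeA leeDl// adde_ge0.
elim: n => [|n IH]; first by rewrite big_ord1 addeC.
rewrite big_ord_recr/= -addeA; apply: le_trans IH.
by rewrite leeD2l// addeC.
Qed.

(** [fine] sends infinities to 0, so the finite bound is what allows [rsum] to be read as the
    extended sum. Identities between real sums are proved after this embedding. *)
Lemma rsumK (I : choiceType) (A : set I) (g : I -> R) (c : R) :
  (forall i, 0 <= g i)%R -> \esum_(i in A) (g i)%:E <= c%:E ->
  (rsum A g)%:E = \esum_(i in A) (g i)%:E.
Proof.
move=> g0 gc; rewrite /rsum fineK// fin_numElt (le_lt_trans gc (ltry _)) andbT.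
by rewrite (@lt_le_trans _ _ 0) ?ltNyr//; apply: esum_ge0 => i _; rewrite lee_fin.
Qed.

Lemma rsum_ge0 (I : choiceType) (A : set I) (g : I -> R) :
  (forall i, 0 <= g i)%R -> (0 <= rsum A g)%R.
Proof. by move=> g0; apply/fine_ge0/esum_ge0 => i _; rewrite lee_fin. Qed.

Lemma distr_subdistr (I : choiceType) (D : I -> R) : is_distr D -> is_subdistr D.
Proof. by move=> [D0 D1]; split => //; rewrite D1. Qed.

Lemma subdistr_le1 (I : choiceType) (D : I -> R) i : is_subdistr D -> (D i <= 1)%R.
Proof.
move=> [D0 D1]; rewrite -lee_fin; apply: le_trans D1.
by apply: (@esum_ge_term _ _ (fun i => (D i)%:E)) => // j; rewrite lee_fin.
Qed.

Lemma le_expect1 (I : choiceType) (D : I -> R) (h : I -> \bar R) :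
  is_subdistr D -> (forall i, h i <= 1) ->
  \esum_(i in [set: I]) ((D i)%:E * h i) <= 1.
Proof.
move=> [D0 D1] h1; apply: le_trans D1; apply: le_esum => i _.
by rewrite -[leRHS]mule1 lee_wpmul2l ?lee_fin.
Qed.

Lemma expectK (I : choiceType) (D h : I -> R) :
  is_subdistr D -> (forall i, 0 <= h i <= 1)%R ->
  (expect D h)%:E = \esum_(i in [set: I]) ((D i)%:E * (h i)%:E).
Proof.
move=> Dsub h01; rewrite /expect (@rsumK _ _ _ 1).
- by apply: eq_esum => i _; rewrite EFinM.
- by move=> i; rewrite mulr_ge0//; [apply Dsub.1|case/andP: (h01 i)].
under eq_esum do rewrite EFinM.
by apply: le_expect1 => // i; rewrite lee_fin; case/andP: (h01 i).
Qed.

Lemma pushK (I J : choiceType) (f : I -> J) (D : I -> R) j : is_subdistr D ->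
  (push f D j)%:E = \esum_(i in f @^-1` [set j]) (D i)%:E.
Proof.
move=> [D0 D1]; apply: (@rsumK _ _ _ 1) => //; apply: le_trans D1.
by apply: esum_le_subset => // i; rewrite lee_fin.
Qed.

Lemma push_ge0 (I J : choiceType) (f : I -> J) (D : I -> R) j :
  is_subdistr D -> (0 <= push f D j)%R.
Proof. by move=> [D0 _]; exact: rsum_ge0. Qed.

Lemma esum_push (I J : choiceType) (f : I -> J) (D : I -> R) (B : set J) :
  is_subdistr D ->
  \esum_(j in B) (push f D j)%:E = \esum_(i in f @^-1` B) (D i)%:E.
Proof.
move=> Ds; under eq_esum do rewrite pushK//.
by rewrite esum_fibers// => i; rewrite lee_fin; apply Ds.1.
Qed.

Lemma push_subdistr (I J : choiceType) (f : I -> J) (D : I -> R) :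
  is_subdistr D -> is_subdistr (push f D).
Proof.
move=> Ds; split=> [j|]; first exact: push_ge0.
by rewrite esum_push//; exact: Ds.2.
Qed.

Lemma push_supp (I J : choiceType) (f : I -> J) (D : I -> R) i :
  is_subdistr D -> supp D i -> supp (push f D) (f i).
Proof.
move=> Ds Di; rewrite /supp /= -lte_fin pushK//.
apply: (@lt_le_trans _ _ (D i)%:E); first by rewrite lte_fin.
by apply: (@esum_ge_term _ _ (fun i => (D i)%:E)) => // k; rewrite lee_fin; apply Ds.1.
Qed.

Lemma supp_push (I J : choiceType) (f : I -> J) (D : I -> R) j :
  is_subdistr D -> supp (push f D) j -> exists2 i, f i = j & supp D i.
Proof.
move=> Ds; rewrite /supp /= -lte_fin pushK// => Dj.
apply: contrapT => nex; move: Dj; rewrite esum1 ?ltxx// => i /= fi.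
have := Ds.1 i; rewrite le0r => /orP[/eqP->//|Di].
by exfalso; apply: nex; exists i.
Qed.

End Esum.

(** * Values of resolutions *)

Definition succeeds (R : realType) (S : choiceType) (Omega : Type)
  (M : plts R S Omega) (s : S) : Prop := exists w, enabled M s (Some w).

Definition active (R : realType) (S : choiceType) (Omega : Type)
  (M : plts R S Omega) (s : S) : Prop := enabled M s None /\ ~ succeeds M s.

Lemma active_prune (R : realType) (S : choiceType) (Omega : Type)
  (M : plts R S Omega) (s : S) : enabled (prune M) s None <-> active M s.
Proof.
split=> [[D [MD nsucc]]|[[D MD] nsucc]].
  by split; [exists D|move=> succ; apply: nsucc].
by exists D; split => // -[_].
Qed.

Lemma success_prune (R : realType) (S : choiceType) (Omega : Type)
    (M : plts R S Omega) (s : S) w :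
  enabled (prune M) s (Some w) <-> enabled M s (Some w).
Proof.
by split=> [[D [MD _]]|[D MD]]; exists D => //; split => // -[].
Qed.

(** This property and [success_stays] carry (A) and (B) over to an arbitrary pLTS labelled by
    success actions, so that they can be used on compositions and on resolutions alike. *)
Definition success_unique (R : realType) (S : choiceType) (Omega : Type)
    (M : plts R S Omega) : Prop :=
  forall s w1 w2, enabled M s (Some w1) -> enabled M s (Some w2) -> w1 = w2.

Definition success_stays (R : realType) (S : choiceType) (Omega : Type)
    (M : plts R S Omega) : Prop :=
  forall s w D, enabled M s (Some w) -> M s None D ->
    forall u, supp D u -> enabled M u (Some w).

Section Value.
Variables (R : realType) (U : choiceType) (Omega : Type) (N : plts R U Omega).

(* The value at states without a tau-transition is irrelevant. *)
Definition successor (r : U) : U -> R :=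
  if pselect (enabled N r None) is left tau then projT1 (cid tau)
  else point_distr R r.

Lemma successor_distr r : is_distr (successor r).
Proof.
rewrite /successor; case: pselect => [tau|_]; last exact: point_distr_is_distr.
exact: (step_distr (projT2 (cid tau))).
Qed.

Lemma successor_step r : enabled N r None -> N r None (successor r).
Proof. by rewrite /successor; case: pselect => // tau _; exact: (projT2 (cid tau)). Qed.

Fixpoint hit (w : Omega) (n : nat) (r : U) : \bar R :=
  match n with
  | 0%N => if `[< enabled N r (Some w) >] then 1 else 0
  | m.+1 => if `[< active N r >]
            then \esum_(u in [set: U]) ((successor r u)%:E * hit w m u) else 0
  end.

Lemma hit_ge0 w n r : 0 <= hit w n r.
Proof.
elim: n r => [|n IH] r /=; case: ifP => // _.
by apply: esum_ge0 => u _; rewrite mule_ge0// lee_fin; apply (successor_distr r).1.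
Qed.

Definition reach (w : Omega) (r : U) : \bar R := \esum_(n in [set: nat]) hit w n r.

Lemma reach_ge0 w r : 0 <= reach w r.
Proof. by apply: esum_ge0 => n _; exact: hit_ge0. Qed.

Lemma esum_expect (I : choiceType) (D : I -> R) (h : nat -> I -> \bar R) :
  (forall i, 0 <= D i)%R -> (forall n i, 0 <= h n i) ->
  \esum_(i in [set: I]) ((D i)%:E * \esum_(n in [set: nat]) h n i) =
  \esum_(n in [set: nat]) \esum_(i in [set: I]) ((D i)%:E * h n i).
Proof.
move=> D0 h0; rewrite exchange_esum; last by move=> n i; rewrite mule_ge0 ?lee_fin.
by apply: eq_esum => i _; rewrite esumZl.
Qed.

(** The term [n = 0] is split off. A state that already succeeds is not active, so its later terms
    vanish; at an active state they are averages over the successors. *)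
Lemma reachE w r :
  reach w r = if `[< enabled N r (Some w) >] then 1
    else if `[< active N r >]
         then \esum_(u in [set: U]) ((successor r u)%:E * reach w u) else 0.
Proof.
rewrite /reach esum_natS; last by move=> k; exact: hit_ge0.
rewrite /=; case: asboolP => [rw|nrw].
  rewrite esum1 ?adde0// => n _ /=.
  by case: asboolP => // -[_ []]; exists w.
rewrite add0e; case: asboolP => _; last by rewrite esum1.
rewrite esum_expect//; first exact: (successor_distr r).1.
by move=> *; exact: hit_ge0.
Qed.

(** Such a [W] bounds every partial sum of [hit w]: at an active state the first [n.+1] terms add up
    to the average over the successors of the first [n] terms, which [W] bounds by induction. *)
Lemma reach_least w (W : U -> R) : (forall r, 0 <= W r)%R ->
  (forall r, enabled N r (Some w) -> (1 <= W r)%R) ->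
  (forall r, active N r ->
    \esum_(u in [set: U]) ((successor r u)%:E * (W u)%:E) <= (W r)%:E) ->
  forall r, reach w r <= (W r)%:E.
Proof.
move=> W0 W1 Wn r; apply: esum_nat_le => [k|n]; first exact: hit_ge0.
elim: n r => [|n IH] r; first by rewrite big_ord0 lee_fin.
rewrite big_ord_recl/=; case: asboolP => [rw|_].
  rewrite big1 ?adde0 ?lee_fin; first exact: W1.
  by move=> i _; case: asboolP => // -[_ []]; exists w.
rewrite add0e; case: asboolP => [ra|_]; last by rewrite big1// lee_fin.
apply: le_trans (Wn _ ra); rewrite -esum_sum; last first.
  by move=> i j _ _; rewrite mule_ge0 ?hit_ge0// lee_fin; apply (successor_distr r).1.
apply: le_esum => u _; rewrite -ge0_sume_distrr; last by move=> *; exact: hit_ge0.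
by rewrite lee_wpmul2l// lee_fin; apply (successor_distr r).1.
Qed.

Lemma reach_le1 w r : reach w r <= 1.
Proof.
apply: (@reach_least w (fun=> 1%R)) => // s _.
by apply: le_expect1 => //; apply/distr_subdistr/successor_distr.
Qed.

Definition value (r : U) (w : Omega) : R := fine (reach w r).

Lemma hitK w n r : (fine (hit w n r))%:E = hit w n r.
Proof.
rewrite fineK// fin_numElt (lt_le_trans _ (hit_ge0 _ _ _)) ?ltNyr//=.
apply: le_lt_trans (ltry 1); apply: le_trans (reach_le1 w r).
by apply: (@esum_ge_term _ _ _ (fun n => hit w n r)) => // j; exact: hit_ge0.
Qed.

Lemma valueK r w : (value r w)%:E = reach w r.
Proof.
rewrite /value fineK// fin_numElt (le_lt_trans (reach_le1 _ _) (ltry _)) andbT.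
by rewrite (lt_le_trans _ (reach_ge0 _ _)) ?ltNyr.
Qed.

Lemma value01 : unit_valued value.
Proof. by move=> r w; rewrite -!lee_fin valueK reach_ge0 reach_le1. Qed.

(** The test for tau does not exclude succeeding states, unlike the one in [reachE]; the two
    equations differ at states that succeed with another action. *)
Lemma value_opE (W : U -> Omega -> R) r w : unit_valued W ->
  (value_op N W r w)%:E =
  if `[< enabled N r (Some w) >] then 1
  else if `[< enabled N r None >]
       then \esum_(u in [set: U]) ((successor r u)%:E * (W u w)%:E) else 0.
Proof.
move=> W01; have nd := distr_subdistr (successor_distr r).
rewrite /value_op; case: asboolP; case: pselect => //= _ _.
case: asboolP => [rt|nrt]; last by case: pselect.
move: nd; rewrite /successor; case: pselect => //= tau nd.
by rewrite expectK.
Qed.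

Hypotheses (Nuniq : success_unique N) (Nstays : success_stays N).

Lemma reach_other r w w' : enabled N r (Some w) -> w' <> w -> reach w' r = 0.
Proof.
move=> rw ww'; rewrite reachE; case: asboolP => [rw'|_].
  by case: ww'; exact: Nuniq rw' rw.
by case: asboolP => // -[_ []]; exists w.
Qed.

(** The equation of [reach] and the value operator can differ only at a state with a tau-transition
    that succeeds with some [w'] other than [w]. There all successors also succeed with [w'], so
    their [reach w] is 0 and both sides vanish. Leastness comes from [reach_least]. *)
Lemma value_is_value : is_value N value.
Proof.
split; first exact: value01.
  apply/funext => r; apply/funext => w; apply: EFin_inj.
  rewrite value_opE; last exact: value01.
  rewrite valueK reachE; case: asboolP => // nrw.
  under eq_esum do rewrite valueK.
  case: asboolP => rt; last by case: asboolP => // -[].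
  case: asboolP => // nact.
  have [w' rw'] : succeeds N r by apply: contrapT => ns; apply: nact.
  rewrite esum1// => u _.
  have /orP[/eqP ->|u0] : (successor r u == 0)%R || (0 < successor r u)%R.
  - by rewrite -le0r; apply (successor_distr r).1.
  - by rewrite mul0e.
  rewrite (@reach_other _ w') ?mule0//.
    exact: Nstays rw' (successor_step rt) _ u0.
  by move=> ww'; apply: nrw; rewrite ww'.
move=> W W01 WE r w; rewrite -lee_fin valueK.
apply: (@reach_least w (W ^~ w)) => {}r.
- by case/andP: (W01 r w).
- move=> rw; rewrite -lee_fin -WE value_opE//.
  by case: asboolP.
move=> [rt ns]; rewrite -[in leRHS]WE value_opE//.
case: asboolP => [rw|_]; first by case: ns; exists w.
by case: asboolP.
Qed.

Lemma is_valueE (V : U -> Omega -> R) : is_value N V -> V = value.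
Proof.
move=> [V01 VE Vl]; have [v01 vE vl] := value_is_value.
apply/funext => r; apply/funext => w; apply/eqP; rewrite eq_le.
by rewrite Vl// vl.
Qed.

(** * Mass evolving along a resolution *)

Variables Lg Ls : nat -> U -> R.
Hypotheses (Lg0 : forall k r, (0 <= Lg k r)%R) (Ls0 : forall k r, (0 <= Ls k r)%R).
Hypothesis LgE : forall k r, ~ active N r -> Lg k r = 0%R.
Hypothesis LsE : forall k r, active N r -> Ls k r = 0%R.
Hypothesis evol : forall k u, (Lg k.+1 u + Ls k.+1 u)%:E =
  \esum_(r in [set: U]) ((Lg k r)%:E * (successor r u)%:E).

(** Mass stopped at an inactive state contributes nothing to [hit w n.+1], and moving mass
    contributes through its successors one step later. By induction only what stops at step [k + n]
    in a state enabling [w] counts. *)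
Lemma evolution_hit w n k :
  \esum_(r in [set: U]) ((Lg k r + Ls k r)%:E * hit w n r) =
  \esum_(r in [set r | enabled N r (Some w)]) (Ls (k + n)%N r)%:E.
Proof.
elim: n k => [|n IH] k.
  rewrite addn0 [RHS]esum_mkcond; apply: eq_esum => r _ /=.
  case: asboolP => rw.
    rewrite mem_set//= LgE ?add0r ?mule1//.
    by move=> [_ []]; exists w.
  by rewrite memNset// mule0.
rewrite addnS -addSn -IH.
under [RHS]eq_esum => u _.
  rewrite evol -hitK -ge0_esumZr; last first.
  - by move=> r; rewrite mule_ge0 ?lee_fin//; apply (successor_distr r).1.
  - exact/fine_ge0/hit_ge0.
  over.
rewrite exchange_esum; last first.
  move=> u r; rewrite !mule_ge0 ?lee_fin//; first by apply (successor_distr r).1.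
  exact/fine_ge0/hit_ge0.
apply: eq_esum => r _ /=; case: asboolP => ra; last first.
  by rewrite mule0 esum1// => u _; rewrite LgE// !mul0e.
rewrite LsE// addr0 -esumZl//; last first.
  by move=> u; rewrite mule_ge0 ?hit_ge0// lee_fin; apply (successor_distr r).1.
by apply: eq_esum => u _; rewrite -muleA hitK.
Qed.

Lemma evolution_reach w :
  \esum_(r in [set: U]) ((Lg 0%N r + Ls 0%N r)%:E * reach w r) =
  \esum_(k in [set: nat]) \esum_(r in [set r | enabled N r (Some w)]) (Ls k r)%:E.
Proof.
rewrite esum_expect; last first.
- by move=> *; exact: hit_ge0.
- by move=> r; rewrite addr_ge0.
by apply: eq_esum => k _; rewrite evolution_hit add0n.
Qed.

End Value.

(** * Lifted relations and derivations *)

Section Lift.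
Variables (R : realType) (S : choiceType) (Q : S -> (S -> R) -> Prop).
Hypothesis Qdistr : forall s D, Q s D -> is_distr D.

(** [w (s, E)] is the part of the mass of [G] at [s] that takes the transition to [E]: one joint
    weighting that flattens the nested sums of the lifting. [classic] supplies the choice structure
    on functions that summation requires. *)
Record lift_weights (G D : S -> R) (w : S * {classic (S -> R)} -> R) : Prop := {
  lift_weights_subdistr : is_subdistr w;
  lift_weights_rel : forall x, (0 < w x)%R -> Q x.1 x.2;
  lift_weights_source : forall s,
    (G s)%:E = \esum_(E in [set: {classic (S -> R)}]) (w (s, E))%:E;
  lift_weights_target : forall t, (D t)%:E =
    \esum_(x in [set: S * {classic (S -> R)}]) ((w x)%:E * ((x.2 : S -> R) t)%:E) }.

(** A pair of zero weight may carry an arbitrary real function, so nonnegativity of [x.2] is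
    available only at positive weight. *)
Lemma weight_rel_cases (w : S * {classic (S -> R)} -> R) :
  (forall x, 0 <= w x)%R -> (forall x, (0 < w x)%R -> Q x.1 x.2) ->
  forall x, w x = 0%R \/ [/\ (0 < w x)%R & is_distr (x.2 : S -> R)].
Proof.
move=> w0 wQ x; have := w0 x; rewrite le0r => /orP[/eqP|wx]; first by left.
by right; split => //; exact: Qdistr (wQ _ wx).
Qed.

Lemma lift_weights_ge0 G D w : lift_weights G D w ->
  forall x t, 0 <= (w x)%:E * ((x.2 : S -> R) t)%:E.
Proof.
case=> -[w0 _] wQ _ _ x t.
have [->|[wx [x0 _]]] := weight_rel_cases w0 wQ x; first by rewrite mul0e.
by rewrite mule_ge0// lee_fin.
Qed.

(** Each transition of positive weight leads to a distribution of mass 1, so both sides are the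
    total of [w]. *)
Lemma lift_weights_mass G D w : lift_weights G D w ->
  \esum_(t in [set: S]) (D t)%:E = \esum_(s in [set: S]) (G s)%:E.
Proof.
move=> lw; case: (lw) => -[w0 _] wQ wG wD.
under eq_esum do rewrite wD.
under [RHS]eq_esum do rewrite wG.
rewrite -(@esum_pair _ _ _ (fun x => (w x)%:E)); last by move=> x; rewrite lee_fin.
rewrite exchange_esum; last by move=> t x; exact: lift_weights_ge0 lw x t.
apply: eq_esum => x _.
have [->|[wx [x0 x1]]] := weight_rel_cases w0 wQ x.
  by rewrite esum1// => t _; rewrite mul0e.
by rewrite esumZl ?x1 ?mule1.
Qed.

Lemma lift_weights01 G D w : lift_weights G D w ->
  (forall s, 0 <= G s <= 1)%R /\ (forall s, 0 <= D s <= 1)%R.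
Proof.
move=> lw; case: (lw) => wsub wQ wG wD; have [w0 w1] := wsub.
split=> s; rewrite -!lee_fin ?wG ?wD; apply/andP; split.
- by apply: esum_ge0 => E _; rewrite lee_fin.
- apply: le_trans w1; rewrite (@esum_pair _ _ _ (fun x => (w x)%:E)); last first.
    by move=> x; rewrite lee_fin.
  apply: (@esum_ge_term _ _ _
    (fun s => \esum_(E in [set: {classic (S -> R)}]) (w (s, E))%:E)) => // t.
  by apply: esum_ge0 => E _; rewrite lee_fin.
- by apply: esum_ge0 => x _; exact: lift_weights_ge0 lw x s.
- apply: le_trans w1; apply: le_esum => x _.
  have [->|[wx xd]] := weight_rel_cases w0 wQ x; first by rewrite mul0e.
  rewrite -[leRHS]mule1 lee_wpmul2l ?lee_fin//.
  exact/subdistr_le1/distr_subdistr.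
Qed.

(** By induction on the lifting: a single transition gets the point weight, and a weighted sum gets
    the same weighted sum of the weights of its parts. *)
Lemma lift_weightsP G D : Defs.lift Q G D -> exists w, lift_weights G D w.
Proof.
elim=> [s E QsE|I p {}G {}D psub _ /choice[w lw]].
  exists (point_distr R (s, E : {classic (S -> R)})).
  split.
  - exact/distr_subdistr/point_distr_is_distr.
  - by move=> x; rewrite /point_distr; case: eqP => [->//|_]; rewrite ltxx.
  - move=> t; rewrite (@esum_single _ _ _ _ (E : {classic (S -> R)}))//.
    + by rewrite /point_distr xpair_eqE eqxx andbT.
    + by rewrite lee_fin /point_distr ler0n.
    + by move=> E' /negbTE nE; rewrite /point_distr xpair_eqE nE andbF.
  - move=> t; rewrite (@esum_single _ _ _ _ (s, E : {classic (S -> R)}))//.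
    + by rewrite /point_distr eqxx mul1e.
    + by rewrite mule_ge0// lee_fin ?(Qdistr QsE).1// /point_distr ler0n.
    + by move=> x /negbTE nx; rewrite /point_distr nx mul0e.
have w0 i x : (0 <= w i x)%R by have [[]] := lw i.
have w1 i x : (w i x <= 1)%R by apply: subdistr_le1; have [] := lw i.
have p0 := psub.1.
have wE x : (expect p (w ^~ x))%:E = \esum_(i in [set: I]) ((p i)%:E * (w i x)%:E).
  by apply: (expectK psub) => i; rewrite w0 w1.
have we0 i x : 0 <= (w i x)%:E by rewrite lee_fin.
have pw0 i x : 0 <= (p i)%:E * (w i x)%:E by rewrite mule_ge0 ?lee_fin.
exists (fun x => expect p (w ^~ x)); split.
- split=> [x|].
    by rewrite -lee_fin wE; apply: esum_ge0 => i _.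
  under eq_esum do rewrite wE.
  rewrite exchange_esum//.
  under eq_esum do rewrite esumZl//.
  by apply: le_expect1 => // i; have [[]] := lw i.
- move=> x; rewrite -lte_fin wE => sx; apply: contrapT => nQ.
  move: sx; rewrite esum1 ?ltxx// => i _.
  have [->|wix] := eqVneq (w i x) 0%R; first by rewrite mule0.
  exfalso; apply: nQ; have [_ wQ _ _] := lw i; apply: wQ.
  by rewrite lt_neqAle eq_sym wix w0.
- move=> s; have G01 i := (lift_weights01 (lw i)).1 s.
  rewrite (expectK psub G01); under [RHS]eq_esum do rewrite wE.
  rewrite exchange_esum//; apply: eq_esum => i _.
  by rewrite esumZl//; have [_ _ -> _] := lw i.
- move=> t; have D01 i := (lift_weights01 (lw i)).2 t.
  rewrite (expectK psub D01).
  transitivity (\esum_(x in [set: S * {classic (S -> R)}]) \esum_(i in [set: I])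
      ((p i)%:E * ((w i x)%:E * ((x.2 : S -> R) t)%:E))).
    rewrite exchange_esum; last first.
      by move=> x i; rewrite mule_ge0 ?lee_fin//; exact: lift_weights_ge0 (lw i) x t.
    apply: eq_esum => i _; rewrite esumZl//; last first.
      by move=> x; exact: lift_weights_ge0 (lw i) x t.
    by have [_ _ _ ->] := lw i.
  apply: eq_esum => x _; rewrite wE.
  (* The scalar pulled out of the sum must be nonnegative. Where [x.2] is negative at [t], every
     [w i x] is 0 and both sides vanish. *)
  have [x0|nx0] := pselect (0 <= (x.2 : S -> R) t)%R.
    rewrite -ge0_esumZr//.
    by apply: eq_esum => i _; rewrite muleA.
  have wx i : w i x = 0%R.
    have [[w0' _] wQ _ _] := lw i.
    have [//|[_ [x0 _]]] := weight_rel_cases w0' wQ x.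
    by case: nx0; apply x0.
  rewrite esum1; last by move=> i _; rewrite wx mul0e mule0.
  by rewrite esum1 ?mul0e// => i _; rewrite wx mule0.
Qed.

End Lift.

Section Derivation.
Variables (R : realType) (S : choiceType) (Omega : Type) (M : plts R S Omega).

Lemma tau_step_mass G D : tau_step M G D ->
  \esum_(t in [set: S]) (D t)%:E = \esum_(s in [set: S]) (G s)%:E.
Proof.
have Qd s E : M s None E -> is_distr E by exact: step_distr.
by move=> /(lift_weightsP Qd)[w lw]; exact: lift_weights_mass Qd _ _ _ lw.
Qed.

Variables (Dgo Dstop : nat -> S -> R).
Hypothesis Dsub : forall k, is_subdistr (Dgo k) /\ is_subdistr (Dstop k).
Hypothesis D0sub : is_subdistr (fun s => Dgo 0%N s + Dstop 0%N s)%R.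
Hypothesis Dstep : forall k, tau_step M (Dgo k) (fun s => Dgo k.+1 s + Dstop k.+1 s)%R.

Let Dgo0 k s : (0 <= Dgo k s)%R. Proof. exact: (Dsub k).1.1. Qed.
Let Dstop0 k s : (0 <= Dstop k s)%R. Proof. exact: (Dsub k).2.1. Qed.

(** Steps preserve mass, so the mass moving at step [k] equals what moves plus what stops at [k.+1],
    and the stopped masses telescope. *)
Lemma stop_mass :
  \esum_(s in [set: S]) \esum_(k in [set: nat]) (Dstop k s)%:E <= 1.
Proof.
rewrite exchange_esum; last by move=> *; rewrite lee_fin.
apply: (@esum_telescope_le _ (fun k => \esum_(s in [set: S]) (Dgo k s)%:E)).
- by move=> k; apply: esum_ge0 => *; rewrite lee_fin.
- by move=> k; apply: esum_ge0 => *; rewrite lee_fin.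
- rewrite -esumD; [|by move=> *; rewrite lee_fin..].
  by have := D0sub.2; under eq_esum do rewrite EFinD.
move=> k; rewrite -esumD; [|by move=> *; rewrite lee_fin..].
by rewrite -(tau_step_mass (Dstep k)).
Qed.

Lemma stop_sumK s : (rsum [set: nat] (fun k => Dstop k s))%:E =
  \esum_(k in [set: nat]) (Dstop k s)%:E.
Proof.
apply: (@rsumK _ _ _ _ 1) => //; apply: le_trans stop_mass.
apply: (@esum_ge_term _ _ _ (fun s => \esum_(k in [set: nat]) (Dstop k s)%:E)) => // t.
by apply: esum_ge0 => *; rewrite lee_fin.
Qed.

Lemma stop_sum_supp k s :
  (0 < Dstop k s)%R -> supp (fun s => rsum [set: nat] (fun k => Dstop k s)) s.
Proof.
rewrite /supp/= -!lte_fin stop_sumK => /lt_le_trans; apply.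
by apply: (@esum_ge_term _ _ _ (fun k => (Dstop k s)%:E)) => // j; rewrite lee_fin.
Qed.

Lemma supp_stop_sum s :
  supp (fun s => rsum [set: nat] (fun k => Dstop k s)) s -> exists k, (0 < Dstop k s)%R.
Proof.
rewrite /supp/= -lte_fin stop_sumK => sp; apply: contrapT => nk.
move: sp; rewrite esum1 ?ltxx// => k _.
have := Dstop0 k s; rewrite le0r => /orP[/eqP->//|Dk].
by exfalso; apply: nk; exists k.
Qed.

Lemma stop_outcomeK w :
  (stable_outcome M (fun s => rsum [set: nat] (fun k => Dstop k s)) w)%:E =
  \esum_(k in [set: nat]) \esum_(s in [set s | enabled M s (Some w)]) (Dstop k s)%:E.
Proof.
have sum0 s : (0 <= rsum [set: nat] (fun k => Dstop k s))%R by exact: rsum_ge0.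
have mass1 : \esum_(s in [set: S]) (rsum [set: nat] (fun k => Dstop k s))%:E <= 1.
  by under eq_esum do rewrite stop_sumK; exact: stop_mass.
rewrite /stable_outcome (@rsumK _ _ _ _ 1)//; last first.
  by apply: le_trans mass1; apply: esum_le_subset => // s; rewrite lee_fin.
rewrite exchange_esum; last by move=> *; rewrite lee_fin.
rewrite esum_mkcond [RHS]esum_mkcond; apply: eq_esum => s _.
have [|ns] := pselect (enabled M s (Some w)); last first.
  by rewrite !memNset// => -[].
(* The restriction to the support in [stable_outcome] discards only states of zero mass. *)
have := sum0 s; rewrite le0r => /orP[/eqP s0|sp] es.
  rewrite [in RHS]mem_set// -stop_sumK s0.
  by rewrite memNset// /supp/= s0 ltxx => -[].
by rewrite !mem_set// stop_sumK.
Qed.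

End Derivation.

(** * From resolutions to derivations *)

Definition simulates (R : realType) (U S : choiceType) (Omega : Type)
    (N : plts R U Omega) (M : plts R S Omega) (f : U -> S) : Prop :=
  (forall r a L, N r a L -> M (f r) a (push f L)) /\
  (forall r a, enabled M (f r) a -> enabled N r a).

Section Simulation.
Variables (R : realType) (U S : choiceType) (Omega : Type).
Variables (N : plts R U Omega) (M : plts R S Omega) (f : U -> S).
Hypothesis fsim : simulates N M f.

Lemma simulates_enabled r a : enabled N r a <-> enabled M (f r) a.
Proof.
by split=> [[L /fsim.1 ML]|/fsim.2//]; exists (push f L).
Qed.

Lemma simulates_active r : active N r <-> active M (f r).
Proof.
by split=> -[/simulates_enabled rt ns]; split=> // -[w /simulates_enabled rw];
  apply: ns; exists w.
Qed.

Lemma simulates_unique : success_unique M -> success_unique N.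
Proof.
by move=> Mu r w1 w2 /simulates_enabled r1 /simulates_enabled; exact: Mu.
Qed.

Lemma simulates_stays : success_stays M -> success_stays N.
Proof.
move=> Ms r w L /simulates_enabled rw NL u Lu; apply/simulates_enabled.
apply: (Ms _ _ _ rw (fsim.1 _ _ _ NL)); apply: push_supp Lu.
exact/distr_subdistr/(step_distr NL).
Qed.

End Simulation.

Lemma push_add (R : realType) (U S : choiceType) (f : U -> S) (D E : U -> R) s :
  is_subdistr D -> is_subdistr E -> is_subdistr (fun u => D u + E u)%R ->
  push f (fun u => D u + E u)%R s = (push f D s + push f E s)%R.
Proof.
move=> Ds Es DEs; apply: EFin_inj; rewrite EFinD !pushK// -esumD.
- by apply: eq_esum => u _; rewrite EFinD.
- by move=> u _; rewrite lee_fin; apply Ds.1.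
- by move=> u _; rewrite lee_fin; apply Es.1.
Qed.

Section ResolutionToDerivation.
Variables (R : realType) (U S : choiceType) (Omega : Type).
Variables (N : plts R U Omega) (M : plts R S Omega) (f : U -> S).
Hypothesis fsim : simulates N M f.
Hypotheses (Muniq : success_unique M) (Mstays : success_stays M).
Variable Lambda : U -> R.
Hypothesis Lsub : is_subdistr Lambda.

(** The weight given to [expect] is [going j], which is named only afterwards: the mass on inactive
    states is left behind at each step. *)
Fixpoint mass (k : nat) : U -> R :=
  match k with
  | 0%N => Lambda
  | j.+1 => fun u =>
      expect (fun r => if `[< active N r >] then mass j r else 0%R) (successor N ^~ u)
  end.

Definition going k r : R := if `[< active N r >] then mass k r else 0%R.
Definition stopped k r : R := if `[< active N r >] then 0%R else mass k r.

Lemma massD k : mass k = (fun r => going k r + stopped k r)%R.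
Proof.
by apply/funext => r; rewrite /going /stopped; case: asboolP; rewrite (addr0, add0r).
Qed.

Lemma restrict_subdistr k : is_subdistr (mass k) ->
  is_subdistr (going k) /\ is_subdistr (stopped k).
Proof.
move=> [m0 m1]; split; split.
- by move=> r; rewrite /going; case: ifP.
- apply: le_trans m1; apply: le_esum => r _; rewrite lee_fin /going.
  by case: ifP.
- by move=> r; rewrite /stopped; case: ifP.
- apply: le_trans m1; apply: le_esum => r _; rewrite lee_fin /stopped.
  by case: ifP.
Qed.

Let successor01 r u : (0 <= successor N r u <= 1)%R.
Proof.
have nd := successor_distr N r; rewrite nd.1/=.
exact/subdistr_le1/distr_subdistr.
Qed.

Let successor_ge0 r u : (0 <= successor N r u)%R. Proof. by case/andP: (successor01 r u). Qed.

Lemma mass_next k u : is_subdistr (mass k) ->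
  (mass k.+1 u)%:E = \esum_(r in [set: U]) ((going k r)%:E * (successor N r u)%:E).
Proof. by move=> /restrict_subdistr[gs _]; exact: expectK. Qed.

(** Each [successor] has mass 1, so a step carries over exactly the moving mass. *)
Lemma mass_subdistr k : is_subdistr (mass k).
Proof.
elim: k => // k IH; have [gs _] := restrict_subdistr IH; split=> [u|].
  by apply: rsum_ge0 => r; rewrite mulr_ge0//; exact: gs.1.
under eq_esum do rewrite mass_next//.
rewrite exchange_esum; last by move=> u r; rewrite mule_ge0 ?lee_fin//; exact: gs.1.
apply: le_trans gs.2; apply: le_esum => r _; rewrite esumZl.
- by have := (successor_distr N r).2 => ->; rewrite mule1.
- exact: gs.1.
- by move=> u; rewrite lee_fin.
Qed.

Let going_sub k : is_subdistr (going k).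
Proof. exact: (restrict_subdistr (mass_subdistr k)).1. Qed.
Let stopped_sub k : is_subdistr (stopped k).
Proof. exact: (restrict_subdistr (mass_subdistr k)).2. Qed.

Lemma push_mass k :
  push f (mass k) = (fun s => push f (going k) s + push f (stopped k) s)%R.
Proof.
apply/funext => s; rewrite massD push_add//.
by rewrite -massD; exact: mass_subdistr.
Qed.

(** The lifting mixes over the active states of the resolution rather than over states of [M],
    because different states over one state of [M] may take different transitions. *)
Lemma push_tau_step k :
  tau_step (prune M) (push f (going k))
    (fun s => push f (going k.+1) s + push f (stopped k.+1) s)%R.
Proof.
have gs := going_sub k.
pose I := {classic {r : U | active N r}}.
have rangeI r : ~ range (@sval U (active N) : I -> U) r -> going k r = 0%R.
  move=> nr; rewrite /going; case: asboolP => // ra.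
  by case: nr; exists (exist _ r ra).
have svalinj : injective (@sval U (active N) : I -> U).
  move=> [r ra] [r' ra'] /= rr'; move: rr' ra ra' => -> ra ra'.
  by congr exist; exact: Prop_irrelevance.
pose p (i : I) := going k (sval i).
have psub : is_subdistr p.
  split=> [i|]; first exact: gs.1.
  apply: le_trans gs.2.
  rewrite [leRHS](esum_inj svalinj)//; first by move=> r; rewrite lee_fin; exact: gs.1.
  by move=> r /rangeI ->.
(* Since [going k] vanishes outside the active states, an average over [U] weighted by it is a
   mixture indexed by [I]. This serves for both the source and the target. *)
have mix (h : U -> R) (e : R) : (forall r, 0 <= h r <= 1)%R ->
    e%:E = \esum_(r in [set: U]) ((going k r)%:E * (h r)%:E) ->
    e = rsum [set: I] (fun i => p i * h (sval i))%R.
  move=> h01 eE; apply: EFin_inj.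
  rewrite [RHS](@expectK _ _ p (fun i => h (sval i)))// eE.
  rewrite (esum_inj svalinj)//.
    move=> r; rewrite mule_ge0// lee_fin; first exact: gs.1.
    by case/andP: (h01 r).
  by move=> r /rangeI ->; rewrite mul0e.
have -> : push f (going k) =
    fun s => rsum [set: I] (fun i => p i * point_distr R (f (sval i)) s)%R.
  apply/funext => s; apply: (mix (fun r => point_distr R (f r) s)).
    by move=> r; rewrite /point_distr; case: eqP; rewrite ?lexx ler01.
  rewrite pushK// esum_mkcond; apply: eq_esum => r _.
  have [/[!inE] /= <-|] := boolP (r \in _); first by rewrite /point_distr eqxx mule1.
  rewrite notin_setE/= /point_distr; case: eqP => [->//|_]; by rewrite mule0.
have -> : (fun s => push f (going k.+1) s + push f (stopped k.+1) s)%R =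
    fun s => rsum [set: I] (fun i => p i * push f (successor N (sval i)) s)%R.
  apply/funext => s; rewrite -[LHS]/((fun s => _ + _)%R s) -push_mass.
  have nsub r : is_subdistr (successor N r) by exact/distr_subdistr/successor_distr.
  apply: (mix (fun r => push f (successor N r) s)).
    by move=> r; rewrite push_ge0// subdistr_le1//; exact: push_subdistr.
  rewrite pushK; last exact: mass_subdistr.
  under eq_esum do rewrite (mass_next _ (mass_subdistr k)).
  rewrite exchange_esum; last by move=> u r; rewrite mule_ge0 ?lee_fin//; exact: gs.1.
  apply: eq_esum => r _; rewrite esumZl; first by rewrite pushK.
    exact: gs.1.
  by move=> u; rewrite lee_fin.
apply: lift_sum => // -[r ra]; apply: lift_point; split.
  by apply: fsim.1; apply: successor_step; exact: ra.1.
by move=> [_ succ]; have /(simulates_active fsim)[_] := ra; apply.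
Qed.

Lemma resolution_derivation (V : U -> Omega -> R) :
  is_value N V ->
  exists2 Lam, extreme_derivation (prune M) (push f Lambda) Lam &
    stable_outcome (prune M) Lam = fun w => expect Lambda (V ^~ w).
Proof.
have Nuniq := simulates_unique fsim Muniq.
have Nstays := simulates_stays fsim Mstays.
move=> /(is_valueE Nuniq Nstays) ->.
pose Dgo k := push f (going k); pose Dstop k := push f (stopped k).
have Dsub k : is_subdistr (Dgo k) /\ is_subdistr (Dstop k).
  by split; exact: push_subdistr.
have D0 : push f Lambda = (fun s => Dgo 0%N s + Dstop 0%N s)%R by rewrite -push_mass.
have D0sub : is_subdistr (fun s => Dgo 0%N s + Dstop 0%N s)%R.
  by rewrite -D0; exact: push_subdistr.
exists (fun s => rsum [set: nat] (fun k => Dstop k s)).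
  split.
    by exists Dgo, Dstop; split => // k; exact: push_tau_step.
  (* Mass in the limit was stopped at some step, hence comes from an inactive state of the
     resolution; a tau-transition surviving the pruning would make that state active. *)
  move=> s /(supp_stop_sum Dsub D0sub push_tau_step)[k].
  move=> /(supp_push (stopped_sub k))[r <-] rk /active_prune.
  move=> /(simulates_active fsim) ra; move: rk.
  by rewrite /supp/= /stopped asboolT// ltxx.
apply/funext => w; apply: EFin_inj.
rewrite (stop_outcomeK Dsub D0sub push_tau_step).
rewrite (expectK Lsub); last by move=> r; exact: value01.
under [RHS]eq_esum do rewrite valueK.
have L0 : Lambda = (fun r => going 0%N r + stopped 0%N r)%R by rewrite -massD.
rewrite [in RHS]L0.
rewrite evolution_reach.
- apply: eq_esum => k _; rewrite esum_push//.
  congr esum; apply/seteqP; split=> r /=.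
    by move=> /success_prune /(simulates_enabled fsim).
  by move=> /(simulates_enabled fsim) /success_prune.
- by move=> k r; exact: (going_sub k).1.
- by move=> k r; exact: (stopped_sub k).1.
- by move=> k r; rewrite /going; case: asboolP.
- by move=> k r; rewrite /stopped; case: asboolP.
- move=> k u; rewrite -[LHS]/((fun r => going k.+1 r + stopped k.+1 r)%R u)%:E.
  by rewrite -massD mass_next//; exact: mass_subdistr.
Qed.

End ResolutionToDerivation.

(** * From derivations to resolutions *)

Section DerivationToResolution.
Variables (R : realType) (S : choiceType) (Omega : Type) (M : plts R S Omega).
Hypotheses (Muniq : success_unique M) (Mstays : success_stays M).
Variables (Dgo Dstop : nat -> S -> R).
Hypothesis Dsub : forall k, is_subdistr (Dgo k) /\ is_subdistr (Dstop k).
Hypothesis D0sub : is_subdistr (fun s => Dgo 0%N s + Dstop 0%N s)%R.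
Hypothesis Dstep : forall k,
  tau_step (prune M) (Dgo k) (fun s => Dgo k.+1 s + Dstop k.+1 s)%R.
Hypothesis Dstable : stable (prune M) (fun s => rsum [set: nat] (fun k => Dstop k s)).

Let E := {classic (S -> R)}.
Variable weight : nat -> S * E -> R.
Hypothesis weightP : forall k, lift_weights (fun s D => prune M s None D)
  (Dgo k) (fun s => Dgo k.+1 s + Dstop k.+1 s)%R (weight k).

(* The tag [Some (k, D)] marks a state that is left at step [k] along [D];
   the tag [None] marks a state where the derivation has stopped. *)
Let U : choiceType := (S * option (nat * E))%type.
Let proj (u : U) : S := u.1.

(** Only tags of step [k] count, so that mass visiting the same state at different steps is kept
    apart. *)
Definition tag_go (k : nat) (u : U) : R :=
  match u.2 with
  | Some (j, D) => if j == k then weight k (u.1, D) else 0%R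
  | None => 0%R
  end.

Definition tag_stop (k : nat) (u : U) : R :=
  if u.2 is None then Dstop k u.1 else 0%R.

Let Dgo0 k s : (0 <= Dgo k s)%R. Proof. exact: (Dsub k).1.1. Qed.
Let Dstop0 k s : (0 <= Dstop k s)%R. Proof. exact: (Dsub k).2.1. Qed.
Let weight0 k x : (0 <= weight k x)%R. Proof. by have [[]] := weightP k. Qed.

Lemma tag_go_ge0 k u : (0 <= tag_go k u)%R.
Proof. by rewrite /tag_go; case: u.2 => [[j D]|//]; case: ifP. Qed.

Lemma tag_stop_ge0 k u : (0 <= tag_stop k u)%R.
Proof. by rewrite /tag_stop; case: u.2. Qed.

Lemma esum_tag_fiber (g : U -> \bar R) s : (forall u, 0 <= g u) ->
  \esum_(u in proj @^-1` [set s]) g u =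
  \esum_(e in [set: option (nat * E)]) g (s, e).
Proof.
move=> g0; rewrite -(@esum_image _ _ _ setT (fun e => (s, e) : U) g); last first.
  by move=> e e' _ _ [].
congr esum; apply/seteqP; split=> [[t e] /= <-|_ [e _ <-]//].
by exists e.
Qed.

(** Over [s], the tag [None] carries [Dstop k s], and the tags [Some (k, D)] carry the weights of
    the transitions from [s], which add up to [Dgo k s]. *)
Lemma tag_fiber_mass k s :
  \esum_(e in [set: option (nat * E)]) (tag_go k (s, e) + tag_stop k (s, e))%:E =
  (Dgo k s + Dstop k s)%:E.
Proof.
rewrite esum_option; last by move=> e; rewrite lee_fin addr_ge0 ?tag_go_ge0 ?tag_stop_ge0.
rewrite [tag_go k (s, None)]/tag_go [tag_stop k (s, None)]/tag_stop /= add0r.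
rewrite addrC EFinD; congr (_ + _).
have [_ _ -> _] := weightP k.
rewrite (@esum_inj _ _ _ (fun D : E => (k, D))).
- by apply: eq_esum => D _; rewrite /tag_go /tag_stop /= eqxx addr0.
- by move=> D D' [].
- by move=> x; rewrite lee_fin addr_ge0 ?tag_go_ge0 ?tag_stop_ge0.
move=> [j D] nr; rewrite /tag_go /tag_stop/= addr0; case: eqP => // jk.
by case: nr; exists D; rewrite ?jk.
Qed.

Lemma esum_weight (g : U -> \bar R) k : (forall u, 0 <= g u) ->
  \esum_(u in [set: U]) ((tag_go k u)%:E * g u) =
  \esum_(x in [set: S * E]) ((weight k x)%:E * g (x.1, Some (k, x.2))).
Proof.
move=> g0; rewrite (@esum_inj _ _ _ (fun x : S * E => (x.1, Some (k, x.2)) : U)).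
- by apply: eq_esum => -[s D] _; rewrite /tag_go /= eqxx.
- by move=> [s D] [s' D'] /= [-> ->].
- by move=> u; rewrite mule_ge0// lee_fin tag_go_ge0.
move=> [s [[j D]|]] nr; rewrite /tag_go /= ?mul0e//.
case: eqP => [jk|]; last by rewrite mul0e.
by case: nr; exists (s, D); rewrite //= jk.
Qed.

(* A state reached at step [k] gets its tag with the conditional probability
   given by the derivation. *)
Definition tag_split (k : nat) (D : S -> R) (u : U) : R :=
  (D u.1 * ((tag_go k u + tag_stop k u) / (Dgo k u.1 + Dstop k u.1)))%R.

Definition tag_none (D : S -> R) (u : U) : R := if u.2 is None then D u.1 else 0%R.

(** The point distribution is an arbitrary default: [resolution] has a step only where the action is
    enabled. *)
Definition default_step (s : S) (a : option Omega) : S -> R :=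
  if pselect (enabled M s a) is left sa then projT1 (cid sa) else point_distr R s.

(** A resolution must enable whatever its image enables, so transitions that the derivation does not
    follow still need a target: a chosen transition of [M] with all mass tagged [None]. *)
Definition target (u : U) (a : option Omega) : U -> R :=
  match a, u.2 with
  | None, Some (k, D) =>
      if (0 < weight k (u.1, D))%R then tag_split k.+1 D
      else tag_none (default_step u.1 a)
  | _, _ => tag_none (default_step u.1 a)
  end.

Lemma tagged_distr (D : S -> R) (L : U -> R) : is_distr D ->
  (forall u, 0 <= L u)%R ->
  (forall s, \esum_(e in [set: option (nat * E)]) (L (s, e))%:E = (D s)%:E) ->
  is_distr L /\ push proj L = D.
Proof.
move=> [D0 D1] L0 LD.
have Ld : is_distr L.
  split=> //; rewrite (@esum_pair _ _ _ (fun u => (L u)%:E)).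
    by under eq_esum do rewrite LD.
  by move=> u; rewrite lee_fin.
split=> //; apply/funext => s; apply: EFin_inj.
rewrite pushK; last exact: distr_subdistr.
by rewrite (@esum_tag_fiber (fun u => (L u)%:E))// => u; rewrite lee_fin.
Qed.

Lemma tag_none_distr D : is_distr D ->
  is_distr (tag_none D) /\ push proj (tag_none D) = D.
Proof.
move=> Dd; apply: tagged_distr => //.
  by move=> u; rewrite /tag_none; case: u.2 => //; exact: Dd.1.
move=> s; rewrite esum_option /tag_none/=.
  by rewrite esum1// adde0.
by move=> [e|]; rewrite lee_fin//; exact: Dd.1.
Qed.

(** The term of [(s, D)] in the total arriving at [t] is bounded by that total. Hence division by a
    zero total in [tag_split] loses no mass. *)
Lemma weight_support k s D : (0 < weight k (s, D))%R ->
  forall t, (Dgo k.+1 t + Dstop k.+1 t)%R = 0%R -> (D : S -> R) t = 0%R.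
Proof.
move=> wk t tot0; have [_ wQ _ wT] := weightP k.
have [D0 _] : is_distr (D : S -> R) by exact: step_distr (wQ _ wk).
have := wT t; rewrite tot0 => /esym sum0.
have := @esum_ge_term _ _ setT
  (fun x => (weight k x)%:E * ((x.2 : S -> R) t)%:E) (s, D) I.
rewrite sum0 /= -EFinM lee_fin => H.
have {}H : (weight k (s, D) * (D : S -> R) t <= 0)%R.
  apply: H => x; apply: (lift_weights_ge0 _ (weightP k)) => ? ?; exact: step_distr.
apply/eqP; rewrite eq_le D0 andbT.
by rewrite pmulr_rle0 in H.
Qed.

(** Over a state with nonzero total the conditional probabilities of the tags add up to 1 by
    [tag_fiber_mass], so summing out the tags gives back [D]; where the total is 0, [D] is 0 too. *)
Lemma tag_split_distr k s D : (0 < weight k (s, D))%R ->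
  is_distr (tag_split k.+1 D) /\ push proj (tag_split k.+1 D) = D.
Proof.
move=> wk; have [_ wQ _ _] := weightP k.
have Dd : is_distr (D : S -> R) by exact: step_distr (wQ _ wk).
have [D0 _] := Dd.
have c0 t : (0 <= Dgo k.+1 t + Dstop k.+1 t)%R by rewrite addr_ge0.
apply: tagged_distr => //.
  move=> u; rewrite /tag_split mulr_ge0// divr_ge0//.
  by rewrite addr_ge0 ?tag_go_ge0 ?tag_stop_ge0.
move=> t; rewrite /tag_split.
under eq_esum do rewrite EFinM EFinM [(_, _).1]/=.
rewrite esumZl//; last first.
  by move=> e; rewrite -EFinM lee_fin divr_ge0// addr_ge0 ?tag_go_ge0 ?tag_stop_ge0.
rewrite ge0_esumZr ?invr_ge0//; last first.
  by move=> e; rewrite lee_fin addr_ge0 ?tag_go_ge0 ?tag_stop_ge0.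
rewrite tag_fiber_mass -!EFinM; congr EFin.
have [t0|t0] := eqVneq (Dgo k.+1 t + Dstop k.+1 t)%R 0%R.
  by rewrite (weight_support wk t0) mul0r.
by rewrite divff// mulr1.
Qed.

Lemma default_stepP s a : enabled M s a -> M s a (default_step s a).
Proof.
by rewrite /default_step; case: pselect => // sa _; exact: projT2 (cid sa).
Qed.

Lemma targetP u a : enabled M (proj u) a ->
  is_distr (target u a) /\ M (proj u) a (push proj (target u a)).
Proof.
move=> /default_stepP Ms.
have [nd np] := tag_none_distr (step_distr Ms).
case: u a Ms nd np => s [[k D]|] [w|] Ms nd np; rewrite /target /=;
  do ?by rewrite np.
case: ifPn => [wk|_]; last by rewrite np.
have [td ->] := tag_split_distr wk.
by split => //; have [_ wQ _ _] := weightP k; have [] := wQ _ wk.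
Qed.

Lemma target_step_distr u a L :
  enabled M (proj u) a /\ L = target u a -> is_distr L.
Proof. by case=> /targetP[d _] ->. Qed.

Definition resolution : plts R U Omega := Plts target_step_distr.

Lemma resolution_det : deterministic resolution.
Proof. by move=> u a L L' [_ ->] [_ ->]. Qed.

Lemma resolution_simulates : simulates resolution M proj.
Proof.
split=> [u a L [ua ->]|u a ua]; first exact: (targetP ua).2.
by exists (target u a).
Qed.

Lemma weight_active k s D : (0 < weight k (s, D))%R -> active M s.
Proof.
have [_ wQ _ _] := weightP k => /wQ MsD.
by apply/active_prune; exists D.
Qed.

Lemma successor_weight k s D : (0 < weight k (s, D))%R ->
  successor resolution (s, Some (k, D)) = tag_split k.+1 D.
Proof.
move=> wk; have [ms _] := weight_active wk.
have : enabled resolution ((s, Some (k, D)) : U) None.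
  by apply: resolution_simulates.2; exact: ms.
by move=> /successor_step[_ ->]; rewrite /target /= wk.
Qed.

(** The conditional probability [c] of the tag of [u] depends on [u] and not on the transition
    taken. It factors out of the sum, leaving the total arriving at [u.1], which cancels the
    denominator of [c]. *)
Lemma tag_evolution k u :
  (tag_go k.+1 u + tag_stop k.+1 u)%:E =
  \esum_(r in [set: U]) ((tag_go k r)%:E * (successor resolution r u)%:E).
Proof.
rewrite (@esum_weight (fun r => (successor resolution r u)%:E)); last first.
  by move=> r; rewrite lee_fin; apply (successor_distr resolution r).1.
set c := ((tag_go k.+1 u + tag_stop k.+1 u) / (Dgo k.+1 u.1 + Dstop k.+1 u.1))%R.
have c0 : (0 <= c)%R.
  by rewrite divr_ge0// addr_ge0 ?tag_go_ge0 ?tag_stop_ge0.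
transitivity (\esum_(x in [set: S * E])
    ((weight k x)%:E * ((x.2 : S -> R) u.1)%:E * c%:E)); last first.
  apply: eq_esum => -[s D] _ /=; have := weight0 k (s, D).
  rewrite le0r => /orP[/eqP->|wk]; first by rewrite !mul0e.
  by rewrite successor_weight// -muleA EFinM.
rewrite ge0_esumZr//; last first.
  by move=> x; apply: (lift_weights_ge0 _ (weightP k)) => ? ?; exact: step_distr.
have [_ _ _ <-] := weightP k.
rewrite -EFinM; congr EFin; rewrite /c.
have [t0|t0] := eqVneq (Dgo k.+1 u.1 + Dstop k.+1 u.1)%R 0%R; last by rewrite mulrC divfK.
(* With a zero total the right side is 0; on the left, the mass of [u] is at most that of its fiber,
   which is 0 as well. *)
rewrite t0 mul0r; apply/eqP; rewrite eq_le addr_ge0 ?tag_go_ge0 ?tag_stop_ge0// andbT.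
rewrite -lee_fin -[in leRHS]t0 -tag_fiber_mass.
have -> : (tag_go k.+1 u + tag_stop k.+1 u)%:E =
  (fun e => (tag_go k.+1 (u.1, e) + tag_stop k.+1 (u.1, e))%:E) u.2 by case: (u).
apply: esum_ge_term => // e.
by rewrite lee_fin addr_ge0 ?tag_go_ge0 ?tag_stop_ge0.
Qed.

Let start (u : U) : R := (tag_go 0%N u + tag_stop 0%N u)%R.

Lemma start_resolution :
  is_resolution M (fun s => Dgo 0%N s + Dstop 0%N s)%R start resolution.
Proof.
have ge0 u : 0 <= (start u)%:E.
  by rewrite lee_fin addr_ge0 ?tag_go_ge0 ?tag_stop_ge0.
have ssub : is_subdistr start.
  split=> [u|]; first by rewrite -lee_fin.
  rewrite (@esum_pair _ _ _ (fun u => (start u)%:E))//.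
  by under eq_esum do rewrite tag_fiber_mass; exact: D0sub.2.
split=> //; first exact: resolution_det.
exists proj; split; [|exact: resolution_simulates.1|exact: resolution_simulates.2].
apply/funext => s; apply: EFin_inj; rewrite pushK//.
by rewrite (@esum_tag_fiber (fun u => (start u)%:E))// tag_fiber_mass.
Qed.

(** [evolution_reach] applies to [tag_go] and [tag_stop]; summing out the tags turns the stopped
    mass of the resolution into [Dstop]. *)
Lemma derivation_value :
  exists2 V, is_value resolution V &
    (fun w => expect start (V ^~ w)) =
    stable_outcome (prune M) (fun s => rsum [set: nat] (fun k => Dstop k s)).
Proof.
have Nuniq := simulates_unique resolution_simulates Muniq.
have Nstays := simulates_stays resolution_simulates Mstays.
have [_ ssub _] := start_resolution.
exists (value resolution); first exact: value_is_value.
apply/funext => w; apply: EFin_inj.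
rewrite (stop_outcomeK Dsub D0sub Dstep).
rewrite (expectK ssub); last by move=> r; exact: value01.
under eq_esum do rewrite valueK.
rewrite evolution_reach.
- apply: eq_esum => k _.
  have stop0 u : 0 <= (tag_stop k u)%:E by rewrite lee_fin tag_stop_ge0.
  have fiber s : (Dstop k s)%:E =
      \esum_(u in proj @^-1` [set s]) (tag_stop k u)%:E.
    rewrite (@esum_tag_fiber (fun u => (tag_stop k u)%:E))// esum_option//.
    by rewrite esum1// adde0.
  under [RHS]eq_esum do rewrite fiber.
  rewrite esum_fibers//; congr esum; apply/seteqP; split=> u /=.
    by move=> /(simulates_enabled resolution_simulates) /success_prune.
  by move=> /success_prune /(simulates_enabled resolution_simulates).
- exact: tag_go_ge0.
- exact: tag_stop_ge0.
- move=> k [s [[j D]|]] na; rewrite /tag_go //=; case: eqP => // jk.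
  apply/eqP; rewrite eq_le weight0 andbT leNgt; apply/negP => /weight_active sa.
  by apply: na; apply/(simulates_active resolution_simulates).
- move=> k [s [//|]] /(simulates_active resolution_simulates) ra; rewrite /tag_stop/=.
  apply/eqP; rewrite eq_le Dstop0 andbT leNgt; apply/negP.
  (* Stopped mass lies in the support of the stable limit, so it cannot sit on an active state. *)
  move=> /(stop_sum_supp Dsub D0sub Dstep)/Dstable; apply.
  exact/active_prune.
- exact: tag_evolution.
Qed.

End DerivationToResolution.

(** Both constructions are combined for an arbitrary pLTS; tests and processes will enter only
    through uniqueness and persistence of success. *)
Lemma extreme_derivation_outcomes (R : realType) (S : choiceType) (Omega : Type)
    (M : plts R S Omega) (Muniq : success_unique M) (Mstays : success_stays M)
    (Delta : S -> R) (Dd : is_subdistr Delta) (o : Omega -> R) :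
  (exists2 Lam, extreme_derivation (prune M) Delta Lam &
     stable_outcome (prune M) Lam = o) <->
  (exists (U : choiceType) (Lambda : U -> R) (N : plts R U Omega)
     (V : U -> Omega -> R),
     [/\ is_resolution M Delta Lambda N, is_value N V &
         o = fun w => expect Lambda (V ^~ w)]).
Proof.
split=> [[_ [[Dgo [Dstop [Dsub D0 Dstep ->]]] Dstable] <-]|].
  have Qd k : exists w, lift_weights (fun s D => prune M s None D)
      (Dgo k) (fun s => Dgo k.+1 s + Dstop k.+1 s)%R w.
    by apply: (lift_weightsP _ (Dstep k)) => s D; exact: step_distr.
  (* Weights for all steps are fixed at once, since together they determine the transitions of the
     resolution. *)
  have [weight weightP] := choice Qd.
  rewrite D0 in Dd *.
  have [V NV VE] := derivation_value Muniq Mstays Dsub Dd Dstep Dstable weightP.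
  do 4 eexists; split; [exact: start_resolution|exact: NV|exact/esym/VE].
move=> [U [Lambda [N [V [[Ndet Lsub [f [fL f1 f2]]] NV ->]]]]].
rewrite -fL; have fsim : simulates N M f by [].
by have [Lam] := resolution_derivation fsim Muniq Mstays Lsub NV; exists Lam.
Qed.

(** * Success in the composition of a test with a process *)

Section Parallel.
Variables (R : realType) (T P : choiceType) (Act Omega : Type).
Variables (MT : plts R T (Act + Omega)) (MP : plts R P Act).

(** Only the rule [par_test] produces a success label; the other two rules produce tau. *)
Lemma par_success t p w :
  enabled (par MT MP) (t, p) (Some w) <-> enabled MT t (Some (inr w)).
Proof.
split=> [[D]|[D step]].
  move Ec: (t, p) => c; move Ea: (Some w) => a step.
  by case: step Ec Ea => // t0 p0 b Th tTh [-> _] bE; exists Th; rewrite -bE in tTh.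
by eexists; exact: (@par_test _ _ _ _ _ MT MP t p (Some w) D).
Qed.

Lemma par_unique : test_condA MT -> success_unique (par MT MP).
Proof. by move=> condA [t p] w1 w2 /par_success t1 /par_success; exact: condA t1. Qed.

(** A tau-step of a composition moves the test by tau or by an action in [Act], where (B) applies,
    or leaves the state of the test fixed. *)
Lemma par_stays : test_condB MT -> success_stays (par MT MP).
Proof.
have supp_left (Th : T -> R) (De : P -> R) c : (forall t, 0 <= Th t)%R ->
    supp (prod_distr Th De) c -> supp Th c.1.
  move=> Th0; rewrite /supp /prod_distr /= => TD.
  rewrite lt_neqAle Th0 andbT eq_sym; apply: contraTneq TD => ->.
  by rewrite mul0r ltxx.
move=> condB [t p] w D /par_success tw.
move Ec: (t, p) => c; move Ea: None => a step.
case: step Ec Ea => {c a D} [t0 p0 a Th tTh|t0 p0 De _|t0 p0 a Th De tTh _]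
  [tE _] aE [t' p'] supp_u; apply/par_success.
- rewrite -tE -aE in tTh.
  (* [omap inr None] and [omap inl None] are both [None], so (B) covers a tau-step of the test
     alone. *)
  by apply: (condB t w None Th tw tTh); apply: supp_left supp_u;
    exact: (step_distr tTh).1.
- rewrite -tE in supp_u.
  have := supp_left _ _ _ (point_distr_is_distr R t).1 supp_u.
  by rewrite /supp /point_distr /=; case: eqP => [->//|_]; rewrite ltxx.
- rewrite -tE in tTh.
  by apply: (condB t w (Some a) Th tw tTh); apply: supp_left supp_u;
    exact: (step_distr tTh).1.
Qed.

End Parallel.

Theorem theorem23 (R : realType) (T P : choiceType) (Act Omega : Type)
    (MT : plts R T (Act + Omega)) (MP : plts R P Act)
    (condA : test_condA MT) (condB : test_condB MT)
    (Theta : T -> R) (Delta : P -> R)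
    (hTheta : is_distr Theta) (hDelta : is_distr Delta) :
  outcomes_d MT MP Theta Delta = outcomes MT MP Theta Delta.
Proof.
have Dd : is_subdistr (prod_distr Theta Delta).
  exact/distr_subdistr/prod_distr_is_distr.
apply/seteqP; split=> o.
  exact: (extreme_derivation_outcomes (par_unique condA) (par_stays condB) Dd o).1.
exact: (extreme_derivation_outcomes (par_unique condA) (par_stays condB) Dd o).2.
Qed.
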